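(* Let $\boldsymbol{x}\in\mathbb{R}^n$, $\boldsymbol{x}\neq\boldsymbol{0}$. Suppose that either (i) the warping function $h$ is concave and $x_i\ge 0$ for all $i$, or (ii) the warping function $h$ is convex and $x_i\le 0$ for all $i$. Then the inner maximization problem $$\max_{\boldsymbol{z}\in\mathbb{R}^n}\ \boldsymbol{z}^\top\boldsymbol{x}\quad\text{s.t.}\quad(\boldsymbol{h}(\boldsymbol{z})-\boldsymbol{\mu})^\top\Sigma^{-1}(\boldsymbol{h}(\boldsymbol{z})-\boldsymbol{\mu})\le F_n^{1-\alpha}$$ has a unique KKT point (in the sense of the KKT conditions given in the context).
   Context: The warping function $h:\mathbb{R}\to\mathbb{R}$ is a continuously differentiable, strictly increasing bijection with $h'(t)>0$ for all $t$; $\boldsymbol{h}(\boldsymbol{z})=[h(z_1),\ldots,h(z_n)]^\top$ and $\nabla\boldsymbol{h}(\boldsymbol{z})=\mathrm{diag}(h'(z_1),\ldots,h'(z_n))$. $\boldsymbol{\mu}\in\mathbb{R}^n$, $\Sigma\in\mathbb{R}^{n\times n}$ is symmetric positive definite, $0<\alpha<1$, and $F_n^{1-\alpha}>0$ is the $(1-\alpha)$-quantile of the $\chi^2$ distribution with $n$ degrees of freedom. A KKT point of the problem is a $\boldsymbol{z}\in\mathbb{R}^n$ for which there is a multiplier $u\ge 0$ satisfying the conditions $$\boldsymbol{x}+2u\,\nabla\boldsymbol{h}(\boldsymbol{z})\,\Sigma^{-1}(\boldsymbol{h}(\boldsymbol{z})-\boldsymbol{\mu})=\boldsymbol{0},\qquad(\boldsymbol{h}(\boldsymbol{z})-\boldsymbol{\mu})^\top\Sigma^{-1}(\boldsymbol{h}(\boldsymbol{z})-\boldsymbol{\mu})=F_n^{1-\alpha}.$$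 (The sign convention in the stationarity condition is the one used here by definition.) *)

(* Defs.v *)
From HB Require Import structures.
From mathcomp Require Import all_boot all_order all_algebra.
From mathcomp Require Import all_classical all_reals all_analysis.
From mathcomp Require Import measurable_realfun.

Set Implicit Arguments.
Unset Strict Implicit.
Unset Printing Implicit Defensive.

Import Order.TTheory GRing.Theory Num.Theory.
Import numFieldNormedType.Exports.

Local Open Scope classical_set_scope.
Local Open Scope ring_scope.

Section ChiSquare.
Context {R : realType}.

Definition add_sqr (p : measurableTypeR R * measurableTypeR R) :
  measurableTypeR R := p.1 ^+ 2 + p.2.

Lemma measurable_add_sqr : measurable_fun setT add_sqr.
Proof.
apply: measurable_funD.
- by apply: measurable_funX; exact: measurable_fst.
- exact: measurable_snd.
Qed.

HB.instance Definition _ :=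
  isMeasurableFun.Build _ _ _ _ add_sqr measurable_add_sqr.

(* Law of Z_1^2 + ... + Z_n^2 for independent standard normal Z_i: the law for
   n.+1 is the image, under (z, s) |-> z^2 + s, of the product of N(0, 1) with
   the law for n. *)
Fixpoint chi2_prob (n : nat) : probability (measurableTypeR R) R :=
  match n with
  | 0 => \d_(0 : measurableTypeR R)
  | m.+1 => distribution (normal_prob 0 1 \x chi2_prob m)%E add_sqr
  end.

(* Generalized inverse of the cumulative distribution function of P; only
   meaningful for 0 < p < 1. *)
Definition quantile (P : probability (measurableTypeR R) R) (p : R) : R :=
  inf [set r : R | (p%:E <= P `]-oo, r]%classic)%E].

End ChiSquare.

Section Warping.
Context {R : realType}.

Definition warping (h : R -> R) : Prop :=
  [/\ forall t, derivable h t 1,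
      continuous (derive1 h),
      {homo h : s t / s < t},
      bijective h
    & forall t, 0 < derive1 h t].

Definition convex_fun (h : R -> R) : Prop :=
  @convex_function R R^o setT h.

Definition concave_fun (h : R -> R) : Prop := convex_fun (fun t => - h t).

Definition posdef n (S : 'M[R]_n) : Prop :=
  S^T = S /\ forall v : 'cV[R]_n, v != 0 -> 0 < (v^T *m S *m v) 0 0.

Definition warp (h : R -> R) n (z : 'cV[R]_n) : 'cV[R]_n := map_mx h z.

Definition grad_warp (h : R -> R) n (z : 'cV[R]_n) : 'M[R]_n :=
  diag_mx (\row_i derive1 h (z i 0)).

(* KKT conditions with level F for: maximize z^T x subject to
   (h(z) - mu)^T S^-1 (h(z) - mu) <= F.  The plus sign in the stationarity
   condition is part of the definition, although u >= 0 then corresponds to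
   minimizing z^T x. *)
Definition kkt_point (h : R -> R) n (mu : 'cV[R]_n) (S : 'M[R]_n) (F : R)
    (x z : 'cV[R]_n) : Prop :=
  exists u : R,
    [/\ 0 <= u,
        x + (2 * u) *: (grad_warp h z *m invmx S *m (warp h z - mu)) = 0
      & ((warp h z - mu)^T *m invmx S *m (warp h z - mu)) 0 0 = F].

End Warping.

(* Main.v *)
Require Import Defs.
From HB Require Import structures.
From mathcomp Require Import all_boot all_order all_algebra.
From mathcomp Require Import all_classical all_reals all_analysis.
From mathcomp Require Import ring lra.

Set Implicit Arguments.
Unset Strict Implicit.
Unset Printing Implicit Defensive.

Import Order.TTheory GRing.Theory Num.Theory.
Import numFieldNormedType.Exports.

Local Open Scope ring_scope.

(** Write A for the inverse of Sigma, F for the quantile, g for the inverse of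
    h, and w = h(z) - mu.  Dividing the stationarity condition by h'(z_i)
    turns it into  2u A w = - c(z)  with  c_i(z) = x_i / h'(z_i)
    ([kkt_pointP]; u > 0 is forced by x != 0).  Now c_i(z) is the derivative of
    y_i |-> x_i g(y_i) at y = h(z), so the KKT points are the points of the
    ellipsoid surface  w^T A w = F  at which minus the gradient of the separable
    function  f(y) = sum_i x_i g(y_i)  is an outward normal.  Both hypotheses on
    h and x make every x_i g convex, and the plus sign in the stationarity
    condition is the one that belongs to minimizing f, a convex problem.

    For existence ([kkt_point_exists]), f has a minimizer on the ellipsoid,
    which is compact ([separable_min_on_ellipsoid]).  Along the segment to any
    other point of the ellipsoid f has a nonnegative right derivative, so the
    minimizer also minimizes the linear form given by the gradient c.  As
    c != 0, that linear form has only one minimizer on the ellipsoid, a negative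
    multiple of Sigma c, which lies on the surface and satisfies the normal
    condition ([linear_min_on_ellipsoid]).

    Uniqueness ([kkt_point_unique]) is a monotonicity argument.  Each c_i is
    nondecreasing in z_i ([scaled_inv_derive1_nondecreasing]), hence for two KKT
    points  (2u A w - 2u' A w')^T (w - w') <= 0.  On the surface the left side
    is  (2u + 2u') (F - w^T A w'),  so  w^T A w' >= F,  and therefore
    (w - w')^T A (w - w') <= 0  and w = w' ([ellipsoid_normal_mono]).

    All this requires F > 0.  Since the chi-square law with n >= 1 degrees of
    freedom gives no mass to the nonpositive reals, right continuity of its
    distribution function keeps the quantile away from 0 ([quantile_gt0]). *)

(** * Positivity of the chi-square quantile *)

Section ChiSquareQuantile.
Context {R : realType}.
Local Open Scope classical_set_scope.

Lemma product_normal_chi2_prob n (A B : set (measurableTypeR R)) :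
  measurable A -> measurable B ->
  ((normal_prob (0 : R) 1 \x chi2_prob n) (A `*` B) =
   normal_prob (0 : R) 1 A * chi2_prob n B)%E.
Proof. exact: product_measure1E. Qed.

Lemma chi2_prob_lt0 n : chi2_prob n `]-oo, (0 : R)[ = 0%E.
Proof.
elim: n => [|n IHn] /=.
  by rewrite /dirac indicE memNset//= in_itv/= ltxx.
apply: (@subset_measure0 _ _ _ (normal_prob 0 1 \x chi2_prob n)%E
  _ (setT `*` `]-oo, 0[)).
- exact: measurable_funPTI.
- exact: measurableX.
- move=> [z s] /=; rewrite !in_itv/= /add_sqr /= => zs; split => //.
  by rewrite (le_lt_trans _ zs)// lerDr sqr_ge0.
- by apply: (etrans (product_normal_chi2_prob _ _ _)) => //; rewrite IHn mule0.
Qed.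

(** The sum z^2 + s is nonpositive only if z = 0, which is a Lebesgue-null event
    and hence null for the normal law, or s < 0, which is null by
    [chi2_prob_lt0].  For zero degrees of freedom the claim fails: the law is
    then the point mass at 0. *)
Lemma chi2_prob_le0 n : chi2_prob n.+1 `]-oo, (0 : R)] = 0%E.
Proof.
apply: (@subset_measure0 _ _ _ (normal_prob 0 1 \x chi2_prob n)%E
  _ ([set 0] `*` setT `|` setT `*` `]-oo, 0[)).
- exact: measurable_funPTI.
- by apply: measurableU; apply: measurableX.
- move=> [z s] /=; rewrite !in_itv/= /add_sqr /= => zs.
  have [s0|s0] := ltP s 0; [by right|left; split => //].
  apply/eqP; rewrite -sqrf_eq0 eq_le sqr_ge0 andbT.
  by rewrite (le_trans _ zs)// lerDl.
- apply/eqP; rewrite eq_le measure_ge0 andbT.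
  apply: (le_trans (measureU2 _ _ _)); [exact: measurableX..|].
  have n0 : normal_prob 0 1 [set (0 : R)] = 0%E.
    apply: ((null_content_dominatesP _ _).1 (normal_prob_dominates _ _)) => //.
    exact: lebesgue_measure_set1.
  rewrite -[leRHS]adde0; apply: leeD.
  + rewrite le_eqVlt; apply/orP; left; apply/eqP.
    by apply: (etrans (product_normal_chi2_prob _ _ _)) => //; rewrite n0 mul0e.
  + rewrite le_eqVlt; apply/orP; left; apply/eqP.
    apply: (etrans (product_normal_chi2_prob _ _ _)) => //.
    by rewrite chi2_prob_lt0 mule0.
Qed.

(** By right continuity the distribution function is still below p at some
    r > 0, so every element of the set whose infimum is the quantile exceeds r.
    The set is nonempty because the distribution function tends to 1 > p. *)
Lemma quantile_gt0 (P : probability (measurableTypeR R) R) (p : R) :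
  P `]-oo, 0] = 0%E -> 0 < p < 1 -> 0 < quantile P p.
Proof.
move=> P0 /andP[p0 p1].
pose idR : measurableTypeR R -> R := idfun.
pose X : {RV P >-> R} := HB.pack idR
  (@isMeasurableFun.Build _ _ _ _ idR (@measurable_id _ _ setT)).
have cdfE r : cdf X r = P `]-oo, r] by [].
have [r r0 Pr] : exists2 r : R, 0 < r & (P `]-oo, r] < p%:E)%E.
  have : cdf X r @[r --> 0^'+] --> cdf X 0 by exact: cdf_right_continuous.
  rewrite cdfE P0 => /fine_cvg /cvgr_lt /(_ _ p0) cdf_lt.
  have [r [r0 Pr]] := filter_ex (filterI (nbhs_right_gt (0 : R)) cdf_lt).
  by exists r => //; rewrite -[ltLHS]fineK ?fin_num_measure// lte_fin.
have [s Ps] : exists s : R, (p%:E <= P `]-oo, s])%E.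
  have /fine_cvg /cvgr_gt /(_ _ p1) /filter_ex[s ps] := cvg_cdfy1 X.
  by exists s; rewrite -[leRHS]fineK ?fin_num_measure// lee_fin ltW.
apply: (lt_le_trans r0); apply: lb_le_inf; first by exists s.
move=> t /= pt; rewrite leNgt; apply/negP => tr.
have : (P `]-oo, t] <= P `]-oo, r])%E.
  by rewrite le_measure ?inE//; apply: subitvPr; rewrite bnd_simp ltW.
by move=> /(le_trans pt); rewrite leNgt Pr.
Qed.

End ChiSquareQuantile.

(** * Positive definite bilinear forms and their ellipsoids *)

Section BilinearForm.
Context {R : realType} {n : nat}.
Implicit Types (A S : 'M[R]_n) (u v w c : 'cV[R]_n).

Definition bform A u v : R := (u^T *m A *m v) 0 0.

Lemma bformDl A u v w : bform A (u + v) w = bform A u w + bform A v w.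
Proof. by rewrite /bform linearD/= !mulmxDl mxE. Qed.

Lemma bformDr A u v w : bform A u (v + w) = bform A u v + bform A u w.
Proof. by rewrite /bform mulmxDr mxE. Qed.

Lemma bformZl A a u v : bform A (a *: u) v = a * bform A u v.
Proof. by rewrite /bform linearZ/= -!scalemxAl mxE. Qed.

Lemma bformZr A a u v : bform A u (a *: v) = a * bform A u v.
Proof. by rewrite /bform -scalemxAr mxE. Qed.

Lemma bformC A u v : A^T = A -> bform A u v = bform A v u.
Proof.
move=> symA; rewrite /bform -[in LHS]symA -[in RHS](trmxK (v^T *m A *m u)).
by rewrite [RHS]mxE !trmx_mul trmxK mulmxA.
Qed.

Lemma bform_ge0 A v : posdef A -> 0 <= bform A v v.
Proof.
move=> [_ posA]; have [->|/posA/ltW//] := eqVneq v 0.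
by rewrite /bform mulmx0 mxE.
Qed.

Lemma bform_le0_eq0 A v : posdef A -> bform A v v <= 0 -> v = 0.
Proof.
move=> [_ posA] Av; apply/eqP; apply: contraT => /posA.
by rewrite ltNge Av.
Qed.

Lemma bform_sqrD A u v : posdef A ->
  bform A (u + v) (u + v) = bform A u u + 2 * bform A u v + bform A v v.
Proof.
by move=> [symA _]; rewrite bformDl !bformDr (bformC v u symA); ring.
Qed.

Lemma posdef_unitmx A : posdef A -> A \in unitmx.
Proof.
move=> pA; rewrite -row_free_unit -kermx_eq0.
apply: contraT => /rowV0Pn[v /sub_kermxP vA v0].
suff /(congr1 trmx)/eqP : v^T = 0 by rewrite trmxK trmx0 (negbTE v0).
by apply: (bform_le0_eq0 pA); rewrite /bform trmxK vA mul0mx mxE.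
Qed.

(** With w = S^-1 v one has  v^T S^-1 v = w^T S w. *)
Lemma posdef_invmx S : posdef S -> posdef (invmx S).
Proof.
move=> pS; have uS := posdef_unitmx pS; have [symS posS] := pS.
split=> [|v v0]; first by rewrite trmx_inv symS.
have w0 : invmx S *m v != 0.
  by apply: contra_neq v0 => w0; rewrite -[v](mulKVmx uS) w0 mulmx0.
by have := posS _ w0; rewrite trmx_mul trmx_inv symS mulmxKV // mulmxA.
Qed.

Lemma bform_invmx A c v : posdef A -> bform A (invmx A *m c) v = (c^T *m v) 0 0.
Proof.
move=> pA; rewrite /bform trmx_mul trmx_inv pA.1.
by rewrite mulmxKV// posdef_unitmx.
Qed.

(** With p = A^-1 c the linear form is  v |-> p^T A v,  and its value at w is at
    most its value at the feasible point - k p of the surface.  Expanding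
    (k p + w)^T A (k p + w)  with this bound gives a nonpositive number, so
    w = - k p. *)
Lemma linear_min_on_ellipsoid A F c w : posdef A -> 0 < F -> c != 0 ->
    bform A w w <= F ->
    (forall v, bform A v v <= F -> (c^T *m w) 0 0 <= (c^T *m v) 0 0) ->
  bform A w w = F /\ exists2 k, 0 < k & A *m w = - k *: c.
Proof.
move=> pA F0 c0 wF wmin; have uA := posdef_unitmx pA.
pose p := invmx A *m c; pose D := bform A p p.
have Ap : A *m p = c by rewrite /p mulKVmx.
have D0 : 0 < D.
  by apply: pA.2; apply: contra_neq c0 => p0; rewrite -Ap p0 mulmx0.
(* The scale that puts - k p on the surface of the ellipsoid. *)
pose k := Num.sqrt (F / D).
have k0 : 0 < k by rewrite sqrtr_gt0 divr_gt0.
have k2D : k ^+ 2 * D = F.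
  by rewrite sqr_sqrtr ?divfK ?gt_eqF// ltW// divr_gt0.
have vF : bform A (- k *: p) (- k *: p) = F.
  by rewrite bformZl bformZr -/D -k2D; ring.
have Bw : bform A p w <= - (k * D).
  by rewrite -mulNr -bformZr !bform_invmx// wmin// vF.
have w0 : k *: p + w = 0.
  apply: (bform_le0_eq0 pA); rewrite bform_sqrD// bformZl bformZr bformZl -/D.
  have := ler_wpM2l (ltW k0) Bw; nra.
have -> : w = - k *: p.
  by rewrite scaleNr; apply/eqP; rewrite -addr_eq0 addrC w0.
by split => //; exists k => //; rewrite -scalemxAr Ap.
Qed.

(** Strict convexity of the ellipsoid in algebraic form: since v and w are on
    its surface, the product that is assumed nonpositive equals
    (a + b)(F - v^T A w),  so  v^T A w >= F,  and then
    (v - w)^T A (v - w) <= 0. *)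
Lemma ellipsoid_normal_mono A F a b v w : posdef A -> 0 < a -> 0 < b ->
    bform A v v = F -> bform A w w = F ->
    ((a *: (A *m v) - b *: (A *m w))^T *m (v - w)) 0 0 <= 0 ->
  v = w.
Proof.
move=> pA a0 b0 vF wF le0.
have E u u' : ((A *m u)^T *m u') 0 0 = bform A u u'.
  by rewrite trmx_mul pA.1.
have leD : (a + b) * (F - bform A v w) <= 0.
  apply: le_trans le0; rewrite le_eqVlt; apply/orP; left; apply/eqP.
  rewrite !scalemxAr -mulmxBr E -scaleNr -[X in v - X]scale1r -scaleNr.
  rewrite bformDl !bformDr !(bformZl, bformZr) vF wF (bformC w v pA.1); ring.
have Fle : F <= bform A v w.
  by rewrite -subr_le0 -(pmulr_rle0 _ (addr_gt0 a0 b0)).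
apply/eqP; rewrite -subr_eq0; apply/eqP/(bform_le0_eq0 pA).
rewrite bform_sqrD// -scaleN1r !(bformZl, bformZr) vF wF; lra.
Qed.

(** Makes the ellipsoid bounded without eigenvalues: the coordinate v_i is
    p^T A v  for p the i-th column of A^-1, and twice such a product is bounded
    by  p^T A p + v^T A v,  by positivity at p + v and p - v. *)
Lemma ellipsoid_coord_bounded A F v i : posdef A -> bform A v v <= F ->
  2 * `|v i 0| <= invmx A i i + F.
Proof.
move=> pA vF.
have Ei u : bform A (invmx A *m delta_mx i 0) u = u i 0.
  by rewrite bform_invmx// trmx_delta -rowE mxE.
have Aii : invmx A i i =
    bform A (invmx A *m delta_mx i 0) (invmx A *m delta_mx i 0).
  by rewrite Ei -colE mxE.
rewrite Aii -(Ei v).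
set p := invmx A *m _.
have := bform_ge0 (p + v) pA; have := bform_ge0 (p + (-1) *: v) pA.
rewrite !bform_sqrD// !(bformZl, bformZr) => h1 h2.
by case: (ler0P (bform A p v)) => _; lra.
Qed.

End BilinearForm.

(** * One-sided minima and convex functions of one variable *)

Section OneSided.
Context {R : realType}.
Implicit Types (f h : R -> R).
Local Open Scope classical_set_scope.

Lemma derive_right_min_ge0 f l :
  is_derive (0 : R) (1 : R) f l ->
  (forall t, 0 < t < 1 -> f 0 <= f t) -> 0 <= l.
Proof.
move=> [/cvg_dnbhs_at_right df <-] fmin; apply: (cvgr_to_ge df).
near=> t; rewrite /= [_%:A]mulr1 addr0 mulr_ge0// ?invr_ge0 ?subr_ge0.
  by rewrite ltW.
by apply: fmin; apply/andP; split.
Unshelve. all: by end_near. Qed.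

Lemma is_derive_along f (x d l : R) : is_derive x 1 f l ->
  is_derive (0 : R) (1 : R) (fun t => f (x + t * d)) (l * d).
Proof.
move=> df; have dfx : is_derive (x + 0 * d) 1 f l by rewrite mul0r addr0.
have dline : is_derive (0 : R) (1 : R) (fun t : R => x + t * d) d.
  by apply: is_derive_eq; rewrite scale0r !add0r mul1r [_%:A]mulr1.
exact: (@is_derive1_comp _ f (fun t : R => x + t * d) 0 _ _ dfx dline).
Qed.

(** The gap between chord and graph, as a function of the position t on the
    segment from a to b, is minimal at t = 0, so its derivative there is
    nonnegative. *)
Lemma convex_derive1_le h a b : convex_fun h ->
  (forall t, derivable h t 1) -> derive1 h a * (b - a) <= h b - h a.
Proof.
move=> cvxh dh; rewrite -subr_ge0.
pose f t := t * (h b - h a) - h (a + t * (b - a)).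
apply: (@derive_right_min_ge0 f).
  have dha : is_derive a 1 h (derive1 h a).
    by rewrite derive1E; apply: DeriveDef.
  have dhab := is_derive_along (b - a) dha.
  by apply: is_derive_eq; rewrite scale0r add0r [_%:A]mulr1.
move=> t /andP[t0 t1]; rewrite /f !mul0r addr0 sub0r.
have := cvxh (Itv01 (ltW t0) (ltW t1)) b a.
rewrite !in_setT => /(_ isT isT).
rewrite [X in h X <= _](_ : _ = a + t * (b - a)); last first.
  by transitivity (t * b + (1 - t) * a); [|ring].
by rewrite convRE/= /unstable.onem; lra.
Qed.

(** Add the two tangent inequalities, at a and at b. *)
Lemma convex_derive1_nondecreasing h : convex_fun h ->
  (forall t, derivable h t 1) -> {homo derive1 h : a b / a <= b}.
Proof.
move=> cvxh dh a b; rewrite le_eqVlt => /predU1P[->//|ab].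
have := convex_derive1_le a b cvxh dh; have := convex_derive1_le b a cvxh dh.
have ba : 0 < b - a by rewrite subr_gt0.
by move=> h1 h2; rewrite -(ler_pM2r ba); lra.
Qed.

End OneSided.

(** * Minimization of separable functions over an ellipsoid *)

Lemma sum_continuous (R : realType) (T : topologicalType) (I : Type) (r : seq I)
    (f : I -> T -> R) : (forall i, continuous (f i)) ->
  continuous (fun x => \sum_(i <- r) f i x).
Proof.
by move=> cf; apply: continuous_big => // -[x y]; exact: cvgD cvg_fst cvg_snd.
Qed.

Section SeparableMin.
Context {R : realType} {n : nat}.
Implicit Types (F : R) (A : 'M[R]_n) (v w : 'cV[R]_n) (phi : 'I_n -> R -> R).
Local Open Scope classical_set_scope.

(** The ellipsoid is closed, and bounded by [ellipsoid_coord_bounded], hence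
    compact. *)
Lemma separable_min_on_ellipsoid A F phi : posdef A -> 0 < F ->
    (forall i, continuous (phi i)) ->
  exists2 w, bform A w w <= F & forall v, bform A v v <= F ->
    \sum_i phi i (w i 0) <= \sum_i phi i (v i 0).
Proof.
move=> pA F0 cphi.
pose q (r : 'rV[R]_n) := bform A r^T r^T.
pose f (r : 'rV[R]_n) := \sum_i phi i (r 0 i).
have cf : continuous f.
  apply: (@sum_continuous R 'rV[R]_n _ _ (fun i r => phi i (r 0 i))) => i r.
  by apply: continuous_comp; [exact: coord_continuous | exact: cphi].
have cqj j : continuous (fun r : 'rV[R]_n => \sum_i r 0 i * A i j).
  apply: (@sum_continuous R 'rV[R]_n _ _ (fun i r => r 0 i * A i j)) => i r.
  exact: (cvgM (@coord_continuous R 1 n 0 i r) (cvg_cst (A i j))).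
have cq : continuous q.
  rewrite (_ : q = fun r => \sum_j (\sum_i r 0 i * A i j) * r 0 j); last first.
    apply/funext => r; rewrite /q /bform trmxK mxE.
    by apply: eq_bigr => j _; rewrite !mxE.
  apply: (@sum_continuous R 'rV[R]_n _ _ (fun j r => _ * r 0 j)) => j r.
  exact: (cvgM (cqj j r) (@coord_continuous R 1 n 0 j r)).
pose E := [set r | q r <= F].
have cE : compact E.
  apply: bounded_closed_compact; last first.
    apply: (@closed_comp _ _ q [set t | t <= F]); last exact: closed_le.
    by move=> r _; exact: cq.
  pose M := \sum_i `|invmx A i i| + F.
  exists M; split; first exact: num_real.
  move=> t Mt r rE; apply: (le_trans _ (ltW Mt)).
  have M0 : 0 <= M by rewrite addr_ge0 ?sumr_ge0// ltW.
  rewrite [leLHS]/Num.norm/= mx_normrE.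
  apply/bigmax_leP; split=> // -[i j] _ /=.
  have := ellipsoid_coord_bounded j pA rE; rewrite mxE (ord1 i) => rj.
  have Mj : `|invmx A j j| <= \sum_i `|invmx A i i|.
    by rewrite (bigD1 j)//= lerDl sumr_ge0.
  have := ler_norm (invmx A j j); have := normr_ge0 (r 0 j); rewrite /M; lra.
have E0 : E !=set0.
  by exists 0; rewrite /E/= /q trmx0 /bform mulmx0 mxE ltW.
have cfE : {within E, continuous f} by exact: continuous_subspaceT.
have [r rE rmin] := EVT_min_rV E0 cE cfE.
exists r^T; first by move: rE; rewrite inE.
move=> v vF.
have vE : v^T \in E by rewrite inE /E/= /q trmxK.
have := rmin _ vE; congr (_ <= _).
  by apply: eq_bigr => i _; rewrite mxE.
by apply: eq_bigr => i _; rewrite mxE.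
Qed.

Lemma ellipsoid_segment A F v w t : posdef A -> 0 <= t <= 1 ->
  bform A v v <= F -> bform A w w <= F ->
  bform A (w + t *: (v - w)) (w + t *: (v - w)) <= F.
Proof.
move=> pA /andP[t0 t1] vF wF.
have := bform_ge0 (v - w) pA.
rewrite -(scaleN1r w) !bform_sqrD// !(bformZl, bformZr, bformDl, bformDr).
rewrite (bformC w v pA.1) => vw.
have : t * bform A v v + (1 - t) * bform A w w <= F by nra.
have : 0 <= t * (1 - t) *
    (bform A v v + 2 * (-1 * bform A v w) + -1 * (-1 * bform A w w)).
  by rewrite mulr_ge0// mulr_ge0// subr_ge0.
nra.
Qed.

(** A minimizer w satisfies the first-order condition  c^T (v - w) >= 0  for all
    v of the convex ellipsoid, where c is the gradient at w.  Thus w also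
    minimizes the linear form c, and [linear_min_on_ellipsoid] yields the
    Lagrange condition with an explicit positive multiplier. *)
Lemma separable_stationary_on_ellipsoid A F phi (dphi : 'I_n -> R -> R) :
    posdef A -> 0 < F ->
    (forall i (t : R), is_derive t 1 (phi i) (dphi i t)) ->
    (forall w, \col_i dphi i (w i 0) != 0) ->
  exists2 w, bform A w w = F &
    exists2 k, 0 < k & A *m w = - k *: \col_i dphi i (w i 0).
Proof.
move=> pA F0 dphiE dphi0.
have [|w wF wmin] := @separable_min_on_ellipsoid A F phi pA F0.
  by move=> i t; apply/differentiable_continuous/derivable1_diffP.
have [|wFE] := linear_min_on_ellipsoid pA F0 (dphi0 w) wF; last by exists w.
move=> v vF; rewrite -subr_ge0.
pose f t := \sum_i phi i (w i 0 + t * (v i 0 - w i 0)).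
apply: (@derive_right_min_ge0 _ f).
  have df i : is_derive (0 : R) (1 : R)
      (fun t => phi i (w i 0 + t * (v i 0 - w i 0)))
      (dphi i (w i 0) * (v i 0 - w i 0)).
    exact: is_derive_along.
  rewrite [X in is_derive _ _ _ X](_ : _ =
      \sum_i dphi i (w i 0) * (v i 0 - w i 0)); last first.
    by rewrite !mxE -sumrB; apply: eq_bigr => i _; rewrite !mxE mulrBr.
  rewrite (_ : f = \sum_i fun t => phi i (w i 0 + t * (v i 0 - w i 0))).
    exact: is_derive_sum.
  by apply/funext => t; rewrite fct_sumE.
move=> t /andP[t0 t1].
have t01 : 0 <= t <= 1 by rewrite !ltW.
have := wmin _ (ellipsoid_segment pA t01 vF wF); congr (_ <= _).
  by apply: eq_bigr => i _; rewrite mul0r addr0.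
by apply: eq_bigr => i _; rewrite !mxE.
Qed.

End SeparableMin.

(** * KKT points *)

(** For concave h the derivative decreases, so 1 / h' increases and y >= 0 keeps
    this direction; for convex h both signs are reversed. *)
Lemma scaled_inv_derive1_nondecreasing (R : realType) (h : R -> R) (y : R) :
  warping h ->
  concave_fun h /\ 0 <= y \/ convex_fun h /\ y <= 0 ->
  {homo (fun t => y / derive1 h t) : s t / s <= t}.
Proof.
move=> [dh _ _ _ h'0] cvx_y s t st.
have inv_le a b : derive1 h a <= derive1 h b ->
    (derive1 h b)^-1 <= (derive1 h a)^-1 by rewrite lef_pV2 ?posrE.
case: cvx_y => [[cch y0]|[cvh y0]].
  apply: ler_wpM2l => //; apply: inv_le; rewrite -lerN2.
  have dNh u : derivable (fun u => - h u) u 1 by apply: derivableN.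
  have := convex_derive1_nondecreasing cch dNh st.
  by rewrite !derive1E !deriveN.
apply: ler_wnM2l => //; apply: inv_le.
exact: convex_derive1_nondecreasing st.
Qed.

Lemma is_derive_warping_inverse (R : realType) (h g : R -> R) (y : R) :
  warping h -> cancel h g -> cancel g h ->
  is_derive y 1 g (derive1 h (g y))^-1.
Proof.
move=> [dh _ _ _ h'0] hK gK; rewrite -[X in is_derive X](gK y).
apply: is_derive_inverse.
- by near=> t; exact: hK.
- by near=> t; apply/differentiable_continuous/derivable1_diffP.
- by rewrite derive1E; apply: DeriveDef.
- by rewrite gt_eqF.
Unshelve. all: by end_near. Qed.

(** The stationarity condition divided by h'(z_i), with a = 2u.  If u were 0, it
    would read x = 0. *)
Lemma kkt_pointP (R : realType) n (h : R -> R) (mu : 'cV[R]_n) S F x z :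
    (forall t, 0 < derive1 h t) -> x != 0 ->
  kkt_point h mu S F x z <->
  (exists2 a, 0 < a & a *: (invmx S *m (warp h z - mu)) =
      - \col_i (x i 0 / derive1 h (z i 0))) /\
  bform (invmx S) (warp h z - mu) (warp h z - mu) = F.
Proof.
move=> h'0 x0; set w := warp h z - mu.
have statE a : x + a *: (grad_warp h z *m invmx S *m w) = 0 <->
    a *: (invmx S *m w) = - \col_i (x i 0 / derive1 h (z i 0)).
  have h'z i : derive1 h (z i 0) != 0 by rewrite gt_eqF.
  rewrite -mulmxA; set v := invmx S *m w.
  split=> [/matrixP st|/matrixP st]; apply/matrixP => i j; have := st i j;
      rewrite /grad_warp !(ord1 j) mul_diag_mx !mxE => e.
    apply: (mulfI (h'z i)); rewrite mulrN [in RHS]mulrCA mulfV// mulr1.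
    by rewrite mulrCA; apply/eqP; rewrite -addr_eq0 addrC; apply/eqP.
  by rewrite mulrCA e mulrN mulrCA mulfV// mulr1 subrr.
split=> [[u [u0 st wF]]|[[a a0 st] wF]].
  split=> //; exists (2 * u); last exact/statE.
  rewrite mulr_gt0// lt_neqAle u0 andbT; apply: contra_neq x0 => u_eq0.
  by move: st; rewrite -u_eq0 mulr0 scale0r addr0.
exists (a / 2); split=> //; first by rewrite divr_ge0 ?ltW.
by rewrite mulrCA mulfV// mulr1; exact/statE.
Qed.

(** In the variable w = h(z) - mu the feasible set is a centred ellipsoid and
    the objective is the separable function with terms  x_i g(mu_i + w_i). *)
Lemma kkt_point_exists (R : realType) n (h : R -> R) (mu x : 'cV[R]_n) S F :
  warping h -> posdef S -> 0 < F -> x != 0 ->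
  exists z, kkt_point h mu S F x z.
Proof.
move=> wh pS F0 x0; have [_ _ _ [g hK gK] h'0] := wh.
pose phi (i : 'I_n) (t : R) := x i 0 * g (mu i 0 + t).
pose dphi (i : 'I_n) (t : R) := x i 0 / derive1 h (g (mu i 0 + t)).
have dphiE i (t : R) : is_derive t 1 (phi i) (dphi i t).
  have dg := is_derive_warping_inverse (mu i 0 + t) wh hK gK.
  have dadd : is_derive t 1 (fun t : R => mu i 0 + t) 1.
    by apply: is_derive_eq; rewrite add0r mulr1.
  have := @is_derive1_comp _ g (fun t : R => mu i 0 + t) t _ _ dg dadd.
  by rewrite mulr1 => dcomp; apply: is_deriveZ.
have dphi0 (w : 'cV[R]_n) : \col_i dphi i (w i 0) != 0.
  apply: contra_neq x0 => /matrixP e; apply/matrixP => i j; rewrite (ord1 j).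
  have /eqP := e i 0; rewrite !mxE mulf_eq0 invr_eq0 (gt_eqF (h'0 _)) orbF.
  by move/eqP.
have [w wF [k k0 wk]] :=
  separable_stationary_on_ellipsoid (posdef_invmx pS) F0 dphiE dphi0.
pose z := \col_i g (mu i 0 + w i 0).
have zw : warp h z - mu = w.
  by apply/matrixP => i j; rewrite !mxE gK !(ord1 j) addrAC subrr add0r.
exists z; apply/kkt_pointP => //; rewrite zw; split=> //.
exists k^-1; first by rewrite invr_gt0.
rewrite wk scalerA mulrN mulVf ?gt_eqF// scaleN1r; congr (- _).
by apply/matrixP => i j; rewrite !mxE.
Qed.

Lemma kkt_point_unique (R : realType) n (h : R -> R) (mu x z1 z2 : 'cV[R]_n)
    S F :
  warping h -> posdef S -> x != 0 ->
  (concave_fun h /\ forall i, 0 <= x i 0) \/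
  (convex_fun h /\ forall i, x i 0 <= 0) ->
  kkt_point h mu S F x z1 -> kkt_point h mu S F x z2 -> z1 = z2.
Proof.
move=> wh pS x0 hx; have [_ _ h_inc h_bij h'0] := wh.
move=> /(kkt_pointP _ _ _ _ h'0 x0)[[a a0 st1] F1].
move=> /(kkt_pointP _ _ _ _ h'0 x0)[[b b0 st2] F2].
have w12 : warp h z1 - mu = warp h z2 - mu.
  apply: (ellipsoid_normal_mono (posdef_invmx pS) a0 b0 F1 F2).
  rewrite st1 st2 opprB addrA subrK mxE; apply: sumr_le0 => i _; rewrite !mxE.
  have xi : concave_fun h /\ 0 <= x i 0 \/ convex_fun h /\ x i 0 <= 0.
    by case: hx => -[]; [left | right].
  have c_mono := scaled_inv_derive1_nondecreasing wh xi.
  have h_mono := ltW_homo h_inc.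
  rewrite opprK addrC.
  have [z12|/ltW z12] := leP (z1 i 0) (z2 i 0).
    by rewrite mulr_ge0_le0// ?subr_ge0 ?subr_le0 ?c_mono ?h_mono.
  by rewrite mulr_le0_ge0// ?subr_ge0 ?subr_le0 ?c_mono ?h_mono.
apply/matrixP => i j; have /addIr/matrixP/(_ i j) := w12.
by rewrite !mxE => /(bij_inj h_bij).
Qed.

Theorem theorem1 (R : realType) (n : nat) (h : R -> R)
    (mu : 'cV[R]_n) (Sigma : 'M[R]_n) (alpha : R) (x : 'cV[R]_n)
    (h_warping : warping h)
    (Sigma_posdef : posdef Sigma)
    (alpha_gt0 : 0 < alpha) (alpha_lt1 : alpha < 1)
    (x_neq0 : x != 0)
    (h_x : (concave_fun h /\ (forall i, 0 <= x i 0)) \/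
           (convex_fun h /\ (forall i, x i 0 <= 0))) :
  exists! z : 'cV[R]_n,
    kkt_point h mu Sigma (quantile (chi2_prob n) (1 - alpha)) x z.
Proof.
have F_gt0 : 0 < quantile (chi2_prob n) (1 - alpha) :> R.
  (* A vector with no entries is 0, so x != 0 gives a degree of freedom. *)
  case: n => [|n] in mu Sigma x Sigma_posdef x_neq0 h_x *.
    by rewrite (flatmx0 x) eqxx in x_neq0.
  apply: quantile_gt0; first exact: chi2_prob_le0.
  by rewrite subr_gt0 alpha_lt1 ltrBlDr ltrDl.
have [z kkt_z] := kkt_point_exists mu h_warping Sigma_posdef F_gt0 x_neq0.
exists z; split=> // z' kkt_z'.
exact: (kkt_point_unique h_warping Sigma_posdef x_neq0 h_x kkt_z kkt_z').
Qed.
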